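(* For every finite simple connected planar graph $G$ with $n$ vertices and $m\ge 1$ edges, $D(G)\le \frac{4n^2}{3m}$.
   Context: $D(G)$ is the diameter of $G$: the maximum over all pairs of vertices of the distance (minimum number of edges on a path) between them. *)

(* Defs.v *)
From HB Require Import structures.
From mathcomp Require Import all_boot all_order all_algebra.
From mathcomp Require Import all_classical all_reals all_analysis.

Set Implicit Arguments.
Unset Strict Implicit.
Unset Printing Implicit Defensive.

Import Order.TTheory GRing.Theory Num.Theory.
Import numFieldNormedType.Exports.

Local Open Scope classical_set_scope.
Local Open Scope ring_scope.

(* A finite simple graph is a symmetric irreflexive relation on a finType. *)
Section Graph.
Variables (T : finType) (e : rel T).

Definition edges : {set {set T}} :=
  [set [set p.1; p.2]%SET | p : T * T & e p.1 p.2]%SET.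

Definition connected_graph : bool :=
  (0 < #|T|)%N && [forall x, forall y, connect e x y].

Definition has_path (x y : T) (k : nat) : bool :=
  [exists p : k.-tuple T,
    [&& path e x p, uniq (x :: p) & last x p == y]].

(* A path has fewer than #|T| edges, so the search range covers every path;
   the value #|T| is returned when x and y are not connected. *)
Definition dist (x y : T) : nat := find (has_path x y) (iota 0 #|T|).

Definition diameter : nat := (\max_(x : T) \max_(y : T) dist x y)%N.

End Graph.

Section Planar.
Variables (R : realType) (T : finType) (e : rel T).

(* [pos] places the vertices and [arc E], restricted to the unit interval,
   draws the edge E; its values off the unit interval and its values for
   sets E that are not edges are irrelevant. *)
Record plane_drawing (pos : T -> R * R) (arc : {set T} -> R -> R * R) : Prop :=
  PlaneDrawing {
    drawing_pos_inj : injective pos;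
    drawing_arc_continuous : forall E, E \in edges e ->
      {within `[0, 1], continuous (arc E)};
    drawing_arc_inj : forall E, E \in edges e ->
      {in `[0, 1] &, injective (arc E)};
    drawing_arc_ends : forall E, E \in edges e ->
      [set arc E 0; arc E 1] = pos @` [set` E];
    drawing_arc_vertex : forall E v (t : R), E \in edges e -> t \in `]0, 1[ ->
      arc E t <> pos v;
    drawing_arc_disjoint : forall E F (s t : R), E \in edges e -> F \in edges e ->
      E != F -> s \in `]0, 1[ -> t \in `]0, 1[ -> arc E s <> arc F t
  }.

Definition planar : Prop := exists pos arc, plane_drawing pos arc.

End Planar.

(* Main.v *)
(** With [D] the diameter we show [m + 3 D <= 4 n]; the theorem then follows from
    AM-GM.  Of planarity only the absence of a K5 minor is used.  It holds
    because two drawn paths joining branch sets of disjoint pairs have positive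
    distance: replacing them by fine paths of L-shaped steps, their number of
    crossings is 0, whereas a parity count shows that for five points of the
    plane the crossings of the 15 pairs of disjoint edges add up to an odd
    number.

    By Mader's theorem a graph without K5 minor on [n >= 3] vertices has at most
    [3 n - 6] edges. If all distance layers strictly between two vertices at
    distance [D] have at least three elements, this gives the bound. Otherwise
    the graph is cut along the at most two vertices of a smaller layer that
    separate the ends; both sides, with these vertices made adjacent, are again
    without K5 minor, and the bound follows by induction on [D]. *)
Require Import Defs.
From Stdlib Require Import Btauto.
From HB Require Import structures.
From mathcomp Require Import all_boot all_order all_algebra.
From mathcomp Require Import all_classical all_reals all_analysis.
(* [fintype] and [finset] come last so that [subsetP], [setUC], etc. are theirs. *)
From mathcomp Require Import zify ring lra fintype finset.

Set Implicit Arguments.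
Unset Strict Implicit.
Unset Printing Implicit Defensive.

Import Order.TTheory GRing.Theory Num.Theory.
Import numFieldNormedType.Exports.

Local Open Scope ring_scope.

(** * Crossing parities of paths of L-shaped steps *)

Lemma addb_xorb a b : a (+) b = xorb a b.
Proof. by case: a b => [] []. Qed.

Section Crossings.
Variables (pt : eqType) (X Y : rel pt).

(* A step from [a] to [b] is drawn as an L: horizontally from [a] at the height
   of [a], then vertically to [b].  [X] and [Y] compare abscissas and ordinates. *)

(* Parity of the number of horizontal segments of the path below [z]. *)
Fixpoint winding (a : pt) (p : seq pt) (z : pt) : bool :=
  if p is b :: p' then ((X a z (+) X b z) && Y a z) (+) winding b p' z
  else false.

(** The first term is the horizontal part of the step [a b] meeting the vertical part of [c d], the
    second the vertical part of [a b] meeting the horizontal part of [c d]. *)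
Definition step_crossing (a b c d : pt) : bool :=
  ((X a d (+) X b d) && (Y a c (+) Y a d))
  (+) ((X b c (+) X b d) && (Y a c (+) Y b c)).

Fixpoint path_step_crossing (a : pt) (p : seq pt) (c d : pt) : bool :=
  if p is b :: p' then step_crossing a b c d (+) path_step_crossing b p' c d
  else false.

Fixpoint path_crossing (a : pt) (p : seq pt) (c : pt) (q : seq pt) : bool :=
  if q is d :: q' then path_step_crossing a p c d (+) path_crossing a p d q'
  else false.

(** While [z] moves along the step from [c] to [d], [winding a p z] flips at each crossing with [p]
    and each time the downward ray from [z] sweeps over an end of [p]; the last two terms record
    these sweeps. *)
Lemma path_step_crossingE a p c d :
  path_step_crossing a p c d =
  winding a p c (+) winding a p d (+) ((X a d (+) X a c) && Y a c)
  (+) ((X (last a p) d (+) X (last a p) c) && Y (last a p) c).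
Proof.
elim: p a => [|b p IHp] a /=; first by rewrite addbb.
rewrite {}IHp /step_crossing.
rewrite !addb_xorb; btauto.
Qed.

Hypothesis X_anti : forall a b, a != b -> X b a = ~~ X a b.
Hypothesis Y_anti : forall a b, a != b -> Y b a = ~~ Y a b.

(** Over the steps of [q], the windings of [p] telescope. The end terms count the steps of [q]
    passing above an end of [p], whereas [winding c q] counts those passing below; together these
    are all steps changing sides of that end, which telescopes to the [X] terms. *)
Lemma path_crossingE a p c q :
  a \notin c :: q -> last a p \notin c :: q ->
  path_crossing a p c q =
  winding a p c (+) winding a p (last c q)
  (+) winding c q a (+) winding c q (last a p)
  (+) (X c a (+) X (last c q) a (+) X c (last a p)
       (+) X (last c q) (last a p)).
Proof.
elim: q c => [|d q IHq] c /=.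
  by move=> _ _; rewrite !addb_xorb; btauto.
rewrite !inE !negb_or => /and3P[ac ad aq] /and3P[lc ld lq].
rewrite path_step_crossingE IHq ?inE ?negb_or ?ad ?aq ?ld ?lq // {IHq}.
rewrite (X_anti ac) (X_anti ad) (X_anti lc) (X_anti ld).
rewrite (Y_anti ac) (Y_anti lc).
rewrite !addb_xorb; btauto.
Qed.

End Crossings.

(** Here [w i j k] stands for the winding of a path from [i] to [j] at [k]; by [path_crossingE] the
    equation says that the paths of two disjoint edges of K5 cross evenly. *)
Lemma K5_parity (w : 'I_5 -> 'I_5 -> 'I_5 -> bool) (X : rel 'I_5) :
  (forall i j, i != j -> X j i = ~~ X i j) ->
  ~ (forall i j k l : 'I_5, uniq [:: i; j; k; l] ->
     w i j k (+) w i j l (+) w k l i (+) w k l j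
     (+) (X k i (+) X l i (+) X k j (+) X l j) = false).
Proof.
move=> Xanti E.
pose t i j k l := w i j k (+) w i j l (+) w k l i (+) w k l j
     (+) (X k i (+) X l i (+) X k j (+) X l j).
have E' i j k l : uniq [:: i; j; k; l] -> t i j k l = false by exact: E.
pose o0 := @Ordinal 5 0 isT; pose o1 := @Ordinal 5 1 isT.
pose o2 := @Ordinal 5 2 isT; pose o3 := @Ordinal 5 3 isT.
pose o4 := @Ordinal 5 4 isT.
(* The windings cancel in pairs, and each of the five 4-subsets of the
   vertices contributes 1 through the comparisons. *)
suff : t o0 o1 o2 o3 (+) t o0 o2 o1 o3 (+) t o0 o3 o1 o2 (+) t o0 o1 o2 o4
  (+) t o0 o2 o1 o4 (+) t o0 o4 o1 o2 (+) t o0 o1 o3 o4 (+) t o0 o3 o1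
  o4 (+) t o0 o4 o1 o3 (+) t o0 o2 o3 o4 (+) t o0 o3 o2 o4 (+) t o0 o4
  o2 o3 (+) t o1 o2 o3 o4 (+) t o1 o3 o2 o4 (+) t o1 o4 o2 o3 = true.
  by rewrite !E'.
rewrite /t (@Xanti o0 o1 isT) (@Xanti o0 o2 isT) (@Xanti o0 o3 isT) (@Xanti o0 o4
  isT) (@Xanti o1 o2 isT) (@Xanti o1 o3 isT) (@Xanti o1 o4 isT) (@Xanti o2
  o3 isT) (@Xanti o2 o4 isT) (@Xanti o3 o4 isT).
by rewrite !addb_xorb; btauto.
Qed.

(** * K5 minors and contractions *)

Definition restrict (T : finType) (h : rel T) (S : {set T}) : rel T :=
  fun u v => [&& u \in S, v \in S & h u v].

Definition connected_in (T : finType) (h : rel T) (S : {set T}) : Prop :=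
  forall u v, u \in S -> v \in S -> connect (restrict h S) u v.

Definition has_K5_minor (T : finType) (W : {set T}) (h : rel T) : Prop :=
  exists B : 'I_5 -> {set T},
    [/\ forall i, B i \subset W, forall i, B i != set0,
        forall i, connected_in h (B i),
        forall i j, i != j -> [disjoint B i & B j] &
        forall i j, i != j -> exists u v, [/\ u \in B i, v \in B j & h u v]].

(** The vertex [x] of [S] represents the contracted set and inherits its neighbours; the other
    vertices of [S] disappear only when the vertex set is shrunk to [x |: (W :\: S)]. *)
Definition contract (T : finType) (h : rel T) (S : {set T}) (x : T) : rel T :=
  fun u v => (u != v) && [|| h u v, (u == x) && [exists s in S, h s v]
                           | (v == x) && [exists s in S, h u s]].

Section Minors.
Variable T : finType.
Implicit Types (W S N : {set T}) (h : rel T) (x u v : T).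

Lemma connected_in_mono h h' S u v :
  (forall u v, u \in S -> v \in S -> h' u v -> h u v) ->
  connect (restrict h' S) u v -> connect (restrict h S) u v.
Proof.
move=> sub; apply: connect_sub => a b /and3P[aS bS hab].
by apply: connect1; rewrite /restrict aS bS sub.
Qed.

Lemma connect_restrictS h S S' u v :
  S' \subset S -> connect (restrict h S') u v -> connect (restrict h S) u v.
Proof.
move=> /subsetP sub; apply: connect_sub => a b /and3P[aS bS hab].
by apply: connect1; rewrite /restrict !sub.
Qed.

Lemma connected_in1 h x : connected_in h [set x].
Proof. by move=> u v /set1P-> /set1P->; exact: connect0. Qed.

Lemma connect_restrict_sym h S :
  symmetric h -> connect_sym (restrict h S).
Proof. by move=> hs; apply: sym_connect_sym => u v; rewrite /restrict hs andbCA. Qed.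

Lemma K5_minor_mono W W' h h' : W' \subset W ->
  (forall u v, u \in W' -> v \in W' -> h' u v -> h u v) ->
  has_K5_minor W' h' -> has_K5_minor W h.
Proof.
move=> sW sh [B [BW B0 Bc Bd Be]]; exists B; split=> // [i|i u v uB vB|i j ij].
- exact: subset_trans (BW i) sW.
- apply: (@connected_in_mono _ h') (Bc i u v uB vB) => a b aB bB.
  by apply: sh; exact: (subsetP (BW i)).
- have [u [v [uB vB huv]]] := Be i j ij; exists u, v; split=> //.
  by apply: sh huv; [exact: (subsetP (BW i)) | exact: (subsetP (BW j))].
Qed.

(** The branch set containing [x], if any, absorbs all of [S]. Since [x] is the only vertex of [S]
    left after the contraction, the other branch sets avoid [S]. *)
Lemma K5_minor_contract W h S x : x \in S -> S \subset W ->
  connected_in h S -> has_K5_minor (x |: (W :\: S)) (contract h S x) ->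
  has_K5_minor W h.
Proof.
move=> xS SW Sc [B [BW B0 Bc Bd Be]].
pose C i := if x \in B i then B i :|: S else B i.
have BC i : B i \subset C i by rewrite /C; case: ifP => // _; exact: subsetUl.
have SC i : x \in B i -> S \subset C i by rewrite /C => ->; exact: subsetUr.
have CE i u : u \in C i -> u \in B i \/ x \in B i /\ u \in S.
  rewrite /C; case: ifP => [xB|_ ->]; last by left.
  by case/setUP; [left | right].
have SB i u : u \in S -> u \in B i -> u = x.
  move=> uS /(subsetP (BW i)); rewrite !inE uS /=.
  by rewrite orbF => /eqP.
exists C; split=> [i|i|i|i j ij|i j ij].
- apply/subsetP => u /CE[/(subsetP (BW i))|[_ /(subsetP SW)//]].
  by rewrite !inE => /orP[/eqP-> | /andP[]//]; exact: (subsetP SW).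
- have [u uB] := set0Pn _ (B0 i).
  by apply/set0Pn; exists u; exact: (subsetP (BC i)).
- have step u v : u \in S -> v \in S -> x \in B i ->
      connect (restrict h (C i)) u v.
    by move=> uS vS xB; apply: connect_restrictS (SC i xB) _; exact: Sc.
  have lift u v : u \in B i -> v \in B i -> connect (restrict h (C i)) u v.
    move=> uB vB; apply: connect_sub (Bc i u v uB vB) => {u v uB vB} u v.
    case/and3P=> uB vB /andP[_ /or3P[huv|/andP[/eqP ux]|/andP[/eqP vx]]].
    + by apply: connect1; rewrite /restrict !(subsetP (BC i)).
    + case/exists_inP=> s sS hsv; rewrite ux in uB *.
      apply: connect_trans (step x s xS sS uB) _; apply: connect1; rewrite /restrict.
      by rewrite (subsetP (SC i uB)) ?(subsetP (BC i)).
    + case/exists_inP=> s sS hus; rewrite vx in vB *.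
      apply: connect_trans (step s x sS xS vB); apply: connect1; rewrite /restrict.
      by rewrite (subsetP (BC i)) // (subsetP (SC i vB)).
  move=> u v /CE[uB|[xB uS]] /CE[vB|[xB' vS]]; first exact: lift.
  + exact: connect_trans (lift u x uB xB') (step x v xS vS xB').
  + exact: connect_trans (step u x uS xS xB) (lift x v xB vB).
  + exact: step.
- apply/pred0P => u /=; apply/negP => /andP[].
  have D a : a \in B i -> a \in B j -> False.
    by move=> ai aj; move/pred0P/(_ a): (Bd i j ij); rewrite /= ai aj.
  move=> /CE[ui|[xi uS]] /CE[uj|[xj uS']]; first exact: (D u).
  + by apply: (D x) xj; rewrite -(SB i u uS' ui).
  + by apply: (D x) xi _; rewrite -(SB j u uS uj).
  + exact: (D x).
- have [u [v [uB vB /andP[_ /or3P[huv|/andP[/eqP ux]|/andP[/eqP vx]]]]]] := Be i j ij.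
  + by exists u, v; rewrite !(subsetP (BC _)).
  + case/exists_inP=> s sS hsv; rewrite ux in uB.
    by exists s, v; rewrite (subsetP (SC i uB)) // (subsetP (BC j)).
  + case/exists_inP=> s sS hus; rewrite vx in vB.
    by exists u, s; rewrite (subsetP (SC j vB)) // (subsetP (BC i)).
Qed.

Lemma K5_minor_clique W h N : N \subset W -> #|N| = 5%N ->
  (forall u v, u \in N -> v \in N -> u != v -> h u v) -> has_K5_minor W h.
Proof.
move=> NW N5 Nc; pose f (i : 'I_5) : T := enum_val (cast_ord (esym N5) i).
have fN i : f i \in N by exact: enum_valP.
have f_inj : injective f by move=> i j /enum_val_inj /cast_ord_inj.
exists (fun i => [set f i]); split=> [i|i|i|i j ij|i j ij].
- by rewrite sub1set (subsetP NW).
- by apply/set0Pn; exists (f i); rewrite set11.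
- exact: connected_in1.
- by rewrite disjoints1 inE (inj_eq f_inj).
- by exists (f i), (f j); rewrite !set11 Nc ?(inj_eq f_inj).
Qed.

(** * Edge counts and Mader's theorem *)

Definition degree W h u : nat := #|[set v in W | h u v]|.
(** For a symmetric irreflexive [h] this is twice the number of edges inside [W]. *)
Definition arc_count W h : nat := (\sum_(u in W) degree W h u)%N.

Lemma contract_sym h S x : symmetric h -> symmetric (contract h S x).
Proof.
move=> hs u v; rewrite /contract hs eq_sym; congr (_ && (_ || _)); rewrite orbC.
by congr (_ && _ || _ && _); apply: eq_existsb => s; rewrite hs.
Qed.

Lemma contract_irr h S x : irreflexive (contract h S x).
Proof. by move=> u; rewrite /contract eqxx. Qed.

Lemma connected_in2 h u v : symmetric h -> h u v -> connected_in h [set u; v].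
Proof.
move=> hs huv a b /set2P[]-> /set2P[]->; rewrite ?connect0 //;
  by apply: connect1; rewrite /restrict !inE !eqxx ?orbT //= hs.
Qed.

(** Contracting an edge loses that edge and, for each common neighbour of its ends, one of two edges
    that become parallel. *)
Lemma arc_count_contract W h u v : symmetric h -> irreflexive h ->
  u \in W -> v \in W -> h u v ->
  (arc_count W h <= arc_count (W :\ v) (contract h [set u; v] u)
     + 2 + 2 * #|[set w in W | h u w && h v w]|)%N.
Proof.
move=> hs hi uW vW huv; set h' := contract _ _ _; set t := [set w in W | _].
have uv : u != v by apply: contraTneq huv => ->; rewrite hi.
have h'u w : w != u -> h' u w = h u w || h v w.
  move=> wu; rewrite /h' /contract eq_sym wu eqxx /= (negbTE wu) /= orbF.
  apply/idP/orP => [/orP[->|/exists_inP[s /set2P[]-> ->]]|[->|hvw]]; auto.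
  by apply/orP; right; apply/exists_inP; exists v; rewrite ?set22.
have h'w w z : h w z -> h' w z.
  by move=> hwz; rewrite /h' /contract hwz andbT; apply: contraTneq hwz => ->; rewrite hi.
(* Inclusion-exclusion: among the neighbours of [u] or [v], only [u] and [v] themselves are not
   neighbours of the merged vertex. *)
have degu : (degree W h u + degree W h v <= degree (W :\ v) h' u + 2 + #|t|)%N.
  rewrite /degree -cardsUI leq_add //.
  - have c2 : (#|[set u; v]| <= 2)%N by rewrite cards2; case: (u != v).
    apply: leq_trans (_ : _ <= #|[set w in W :\ v | h' u w] :|: [set u; v]|)%N _.
      apply: subset_leq_card.
      apply/subsetP => w; rewrite !inE; have [->|wu] := eqVneq w u; first by rewrite orbT.
      by have [//|wv] := eqVneq w v; rewrite ?orbT // h'u //= orbF -andb_orr.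
    by apply: leq_trans (leq_card_setU _ _) _; exact: leq_add.
  - apply: subset_leq_card; apply/subsetP => w; rewrite !inE.
    by case/andP=> /andP[-> ->] /andP[_ ->].
(* A neighbour of [v] loses the arc to [v] but gains one to [u], unless it was already adjacent to
   [u]. *)
have degw w : w \in W -> w != u -> w != v ->
    (degree W h w <= degree (W :\ v) h' w + (w \in t))%N.
  move=> wW wu wv; rewrite /degree (cardsD1 v).
  have -> : (v \in [set z in W | h w z]) = h w v by rewrite inE vW.
  have sub : [set z in W | h w z] :\ v \subset [set z in W :\ v | h' w z].
    by apply/subsetP => z; rewrite !inE => /and3P[-> -> /h'w->].
  have [hwv|_] /= := boolP (h w v); last first.
    by rewrite add0n (leq_trans (subset_leq_card sub)) // leq_addr.
  have [wt|wt] := boolP (w \in t).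
    by rewrite addnC leq_add2r subset_leq_card.
  have huw : ~~ h u w by move: wt; rewrite !inE wW /= (hs v) hwv andbT.
  rewrite addn0 [X in (_ <= X)%N](cardsD1 u).
  have -> : u \in [set z in W :\ v | h' w z].
    rewrite !inE uv uW /= /h' /contract wu eqxx /=; apply/orP; right; apply/orP; right.
    by apply/exists_inP; exists v; rewrite ?set22.
  rewrite leq_add2l; apply: subset_leq_card; apply/subsetP => z zN.
  rewrite in_setD1 (subsetP sub) // andbT.
  by apply: contraNneq huw => <-; rewrite hs; move: zN; rewrite !inE => /and3P[].
have tsum : (\sum_(w in W :\ v :\ u) (w \in t) <= #|t|)%N.
  rewrite -sum1_card big_mkcond [X in (_ <= X)%N]big_mkcond; apply: leq_sum => w _.
  by case: (_ \in _).
have vWu : u \in W :\ v by rewrite !inE uv.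
rewrite /arc_count (big_setD1 v vW) (big_setD1 u vWu) [in X in (_ <= X)%N](big_setD1 u vWu) /=.
have : (\sum_(w in W :\ v :\ u) degree W h w <=
    \sum_(w in W :\ v :\ u) degree (W :\ v) h' w + \sum_(w in W :\ v :\ u) (w \in t))%N.
  rewrite -big_split /=; apply: leq_sum => w /setD1P[wu /setD1P[wv wW]].
  exact: degw.
lia.
Qed.

Lemma degree_ltn W h u : irreflexive h -> u \in W -> (degree W h u < #|W|)%N.
Proof.
move=> hi uW; rewrite /degree (cardsD1 u W) uW add1n ltnS subset_leq_card //.
apply/subsetP => v; rewrite !inE => /andP[-> huv]; rewrite andbT.
by apply: contraTneq huv => ->; rewrite hi.
Qed.

Lemma degree_delete W h u v : v \in W ->
  degree W h u = (degree (W :\ v) h u + h u v)%N.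
Proof.
move=> vW; rewrite /degree (cardsD1 v) addnC; congr (_ + _)%N.
  by congr #|pred_of_set _|; apply/setP => z; rewrite !inE andbA.
by rewrite inE vW.
Qed.

Lemma arc_count_delete W h v : symmetric h -> irreflexive h -> v \in W ->
  arc_count W h = (arc_count (W :\ v) h + 2 * degree W h v)%N.
Proof.
move=> hs hi vW; rewrite /arc_count (big_setD1 v vW) /=.
have -> : (\sum_(u in W :\ v) degree W h u =
    \sum_(u in W :\ v) degree (W :\ v) h u + \sum_(u in W :\ v) h u v)%N.
  by rewrite -big_split; apply: eq_bigr => u _; exact: degree_delete.
have -> : (\sum_(u in W :\ v) h u v)%N = degree W h v.
  rewrite (degree_delete h v vW) hi addn0 /degree -sum1_card.
  rewrite big_mkcond [RHS]big_mkcond; apply: eq_bigr => u _.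
  by rewrite !inE (hs u v); case: (u != v); case: (u \in W); case: (h v u).
lia.
Qed.

Definition delete_edge h a b : rel T :=
  fun u v => h u v && ([set u; v] != [set a; b]).

Lemma delete_edge_sym h a b : symmetric h -> symmetric (delete_edge h a b).
Proof. by move=> hs u v; rewrite /delete_edge hs (setUC [set u]). Qed.

Lemma arc_count_delete_edge W h a b : symmetric h -> irreflexive h ->
  a \in W -> b \in W -> h a b ->
  arc_count W h = (arc_count W (delete_edge h a b) + 2)%N.
Proof.
move=> hs hi aW bW hab.
have ab : a != b by apply: contraTneq hab => ->; rewrite hi.
have D u w : u != a -> u != b -> delete_edge h a b u w = h u w.
  move=> ua ub; rewrite /delete_edge (_ : _ != _) ?andbT //.
  by apply/eqP => /setP/(_ u); rewrite !inE eqxx (negbTE ua) (negbTE ub) /=.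
have D1 u c w : w != c -> [set u; c] = [set a; b] -> u != c ->
    delete_edge h a b u w = h u w.
  move=> wc E uc; rewrite /delete_edge -E (_ : _ != _) ?andbT //.
  apply/eqP => /setP/(_ c); rewrite !inE eqxx orbT (eq_sym c) (negbTE uc).
  by rewrite eq_sym (negbTE wc) /=.
have C u c : [set u; c] = [set a; b] -> u != c -> c \in W -> h u c ->
    degree W h u = (degree W (delete_edge h a b) u + 1)%N.
  move=> E uc cW huc; rewrite /degree (cardsD1 c) inE cW huc addnC.
  congr (#|pred_of_set _| + _)%N; apply/setP => w; rewrite !inE.
  have [->|wc] := eqVneq w c; last by rewrite (D1 u c w).
  by rewrite /delete_edge E eqxx andbF andbF.
have ba : a \in W :\ b by rewrite !inE ab.
rewrite /arc_count !(big_setD1 b bW) !(big_setD1 a ba) /=.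
have -> : (\sum_(i in W :\ b :\ a) degree W (delete_edge h a b) i =
    \sum_(i in W :\ b :\ a) degree W h i)%N.
  apply: eq_bigr => u /setD1P[ua /setD1P[ub _]]; congr #|pred_of_set _|.
  by apply/setP => w; rewrite !inE D.
have hba : h b a by rewrite hs.
have ba' : b != a by rewrite eq_sym.
rewrite (C a b erefl ab bW hab) (C b a (setUC _ _) ba' aW hba); lia.
Qed.

Lemma exists_degree_le5 W h :
  (arc_count W h < 6 * #|W|)%N -> exists2 v, v \in W & (degree W h v <= 5)%N.
Proof.
move=> lt; apply/exists_inP; apply/contraTT: lt; rewrite negb_exists_in -leqNgt.
move=> /forall_inP H; rewrite mulnC -sum_nat_const; apply: leq_sum => v vW.
by have := H v vW; rewrite -ltnNge.
Qed.

(** Each element of [N] misses at most one other, so the non-adjacent pairs in [N] form a matching,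
    which is empty if [N] has four elements. If [N] is a clique, it gives a K5, alone or together
    with [v]; otherwise one edge inside [N] is contracted. *)
Lemma K5_minor_neighborhood W h v (N := [set w in W | h v w]) :
  symmetric h -> irreflexive h -> v \in W -> (0 < #|N| <= 5)%N ->
  (forall x, x \in N -> (3 <= #|[set w in N | h x w]|)%N) ->
  has_K5_minor W h.
Proof.
move=> hs hi vW /andP[N0 N5] N3.
have vN : v \notin N by rewrite inE hi andbF.
have NW : N \subset W by apply/subsetP => x; rewrite inE => /andP[].
have hv x : x \in N -> h v x by rewrite inE => /andP[].
(* In [N], the vertex [x], its three or more neighbours and its non-neighbours in [S] are
   disjoint. *)
have miss x (S : {set T}) : x \in N -> S \subset N -> x \notin S ->
    (forall y, y \in S -> ~~ h x y) -> (#|S| + 4 <= #|N|)%N.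
  move=> xN SN xS Sh; have := N3 x xN.
  have : (#|[set w in N | h x w] :|: (x |: S)| <= #|N|)%N.
    apply: subset_leq_card; rewrite subUset subUset sub1set xN SN !andbT.
    by apply/subsetP => w; rewrite inE => /andP[].
  rewrite cardsU (_ : _ :&: _ = set0) ?cards0 ?cardsU1 ?xS; first lia.
  apply/setP => w; rewrite !inE; apply/negP => /andP[/andP[_ hxw]].
  by case/orP => [/eqP wx|/Sh]; [move: hxw; rewrite wx hi | rewrite hxw].
have miss1 x y : x \in N -> y \in N -> x != y -> ~~ h x y -> (5 <= #|N|)%N.
  move=> xN yN xy hxy; have := miss x [set y] xN.
  by rewrite cards1 sub1set inE => /(_ yN xy); apply=> z /set1P->.
have N4 : (4 <= #|N|)%N.
  have [x xN] := card_gt0P N0.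
  by have := miss x set0 xN (sub0set _); rewrite cards0 inE; apply=> // y; rewrite inE.
have miss2 x y z : x \in N -> y \in N -> z \in N -> x != y -> x != z -> y != z ->
    ~~ h x y -> h x z.
  move=> xN yN zN xy xz yz hxy; apply: contraT => hxz.
  have := miss x [set y; z] xN; rewrite cards2 yz subUset !sub1set yN zN.
  rewrite !inE negb_or xy xz => /(_ isT isT) H.
  have /leq_trans/(_ N5) // : (2 + 4 <= #|N|)%N by apply: H => w /set2P[]->.
have [/forall_inP complete | ] :=
  boolP [forall x in N, forall y in N, (x != y) ==> h x y].
  have hN x y : x \in N -> y \in N -> x != y -> h x y.
    by move=> /complete/forall_inP H /H/implyP; apply.
  have [N4'|N5'] : #|N| = 4%N \/ #|N| = 5%N by lia.
    apply: (@K5_minor_clique _ _ (v |: N)).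
    - by rewrite subUset sub1set vW NW.
    - by rewrite cardsU1 vN N4'.
    - move=> x y /setU1P[->|xN] /setU1P[->|yN]; rewrite ?eqxx //.
      + by move=> _; exact: hv.
      + by rewrite hs => _; exact: hv.
      + exact: hN.
  exact: K5_minor_clique NW N5' hN.
rewrite negb_forall_in => /exists_inP[a aN]; rewrite negb_forall_in.
case/exists_inP => b bN; rewrite negb_imply => /andP[ab hab].
have N5' : #|N| = 5%N by have := miss1 a b aN bN ab hab; lia.
have hba : ~~ h b a by rewrite hs.
have ba : b != a by rewrite eq_sym.
(* N is a 5-set with at most two non-adjacent pairs: {a,b} and possibly {c,d}.
   Contracting the edge {a,c} leaves a clique. *)
have [c [cN ca cb Hc]] : exists c, [/\ c \in N, c != a, c != b &
    forall y z, y \in N :\ a :\ c -> z \in N :\ a :\ c -> y != z -> h y z].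
  have bN' y z : y \in N :\ a :\ z -> b != y -> h b y.
    rewrite !inE => /and3P[_ ya yN] yb.
    by apply: (miss2 b a y) => //; rewrite ?inE // eq_sym.
  (* If there is a second non-adjacent pair, [c] is taken from it, so that the edge from [a] to [c]
     meets both pairs. *)
  have [/exists_inP[c cN /exists_inP[d dN /andP[cd hcd]]]|] := boolP
     [exists c in N :\ a :\ b, exists d in N :\ a :\ b, (c != d) && ~~ h c d].
    move: cN dN; rewrite !in_setD1 => /and3P[cb ca cN] /and3P[db da dN].
    exists c; split=> // y z yN zN yz.
    have [yb|yb] := eqVneq y b; first by rewrite yb (bN' z c) // -yb.
    have [zb|zb] := eqVneq z b; first by rewrite zb hs (bN' y c) // -zb eq_sym.
    move: yN zN; rewrite !in_setD1 => /and3P[yc ya yN] /and3P[zc za zN].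
    apply: contraT => hyz.
    have hcy : h c y by rewrite hs; apply: (miss2 y z c).
    have zy : z != y by rewrite eq_sym.
    have hzy : ~~ h z y by rewrite hs.
    have hcz : h c z by rewrite hs; apply: (miss2 z y c).
    have dy : d != y by apply: contraNneq hcd => ->.
    have dz : d != z by apply: contraNneq hcd => ->.
    (* A third non-adjacent pair would give six distinct elements of [N]. *)
    have : (size [:: a; b; c; d; y; z] <= size (enum N))%N.
      apply: uniq_leq_size; last first.
        move=> w; rewrite mem_enum !in_cons in_nil orbF.
        by case/or4P=> [/eqP->|/eqP->|/eqP->|/or3P[] /eqP->].
      rewrite /= !inE !negb_or ab (eq_sym a) ca (eq_sym a) da (eq_sym a) ya (eq_sym a) za.
      rewrite (eq_sym b) cb (eq_sym b) db (eq_sym b) yb (eq_sym b) zb.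
      by rewrite cd (eq_sym c) yc (eq_sym c) zc dy dz yz.
    by rewrite -cardE N5'.
  rewrite negb_exists_in => /forall_inP none.
  have /card_gt0P[c cN] : (0 < #|N :\ a :\ b|)%N.
    have := cardsD1 a N; have := cardsD1 b (N :\ a).
    by rewrite N5' aN in_setD1 ba bN => ->; case: #|_|.
  have := none c cN; rewrite negb_exists_in => /forall_inP nonec.
  move: (cN); rewrite !in_setD1 => /and3P[cb ca cN'].
  exists c; split=> // y z yN zN yz.
  have [yb|yb] := eqVneq y b; first by rewrite yb (bN' z c) // -yb.
  have [zb|zb] := eqVneq z b; first by rewrite zb hs (bN' y c) // -zb eq_sym.
  have yN' : y \in N :\ a :\ b.
    by move: yN; rewrite !in_setD1 yb => /and3P[_ -> ->].
  have zN' : z \in N :\ a :\ b.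
    by move: zN; rewrite !in_setD1 zb => /and3P[_ -> ->].
  have := none y yN'; rewrite negb_exists_in => /forall_inP/(_ z zN').
  by rewrite yz /= negbK.
have hcb : h c b.
  by rewrite hs; apply: (miss2 b a c) => //; rewrite eq_sym.
have acW : [set a; c] \subset W by rewrite subUset !sub1set !(subsetP NW).
have vc : v != c by apply: contraNneq vN => ->.
have hac : h a c by apply: (miss2 a b c) => //; rewrite eq_sym.
apply: (@K5_minor_contract W h [set a; c] a) => //; rewrite ?set21 //.
  exact: connected_in2.
have NcW : N :\ c \subset a |: W :\: [set a; c].
  apply/subsetP => y; rewrite !inE negb_or => /and3P[-> -> _].
  by case: (y == a).
apply: (@K5_minor_clique _ _ (v |: (N :\ c))).
- rewrite subUset NcW sub1set !inE negb_or vc vW.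
  by case: (v == a).
- by rewrite cardsU1 in_setD1 (negbTE vN) andbF; have := cardsD1 c N; rewrite cN N5'.
have sub y z : h y z -> y != z -> contract h [set a; c] a y z.
  by rewrite /contract => -> ->.
have ca_clique z : z \in N :\ c -> a != z -> contract h [set a; c] a a z.
  rewrite in_setD1 => /andP[zc zN] az; have [zb|zb] := eqVneq z b.
    rewrite /contract az eqxx /=; apply/orP; right; apply/orP; left.
    by apply/exists_inP; exists c; rewrite ?set22 // zb.
  by apply: sub => //; apply: (miss2 a b z) => //; rewrite eq_sym.
move=> y z /setU1P[->|yN] /setU1P[->|zN] yz; first by rewrite eqxx in yz.
- by apply: sub => //; apply: hv; case/setD1P: zN.
- by apply: sub => //; rewrite hs; apply: hv; case/setD1P: yN.
have [ya|ya] := eqVneq y a; first by rewrite ya; apply: ca_clique; rewrite // -ya.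
have [za|za] := eqVneq z a.
  by rewrite za contract_sym //; apply: ca_clique; rewrite // eq_sym.
apply: sub => //; apply: Hc => //.
  by move: yN; rewrite !in_setD1 ya => /andP[-> ->].
by move: zN; rewrite !in_setD1 za => /andP[-> ->].
Qed.

(** Induction on the number of vertices, then of arcs. Deleting surplus edges leaves a vertex [v] of
    degree at most 5. Either [K5_minor_neighborhood] applies to [v], or some edge at [v] has at most
    two common neighbours; contracting it loses at most six arcs, exactly the drop of the bound for
    one vertex less. *)
Lemma mader W h : symmetric h -> irreflexive h -> (3 <= #|W|)%N ->
  (6 * #|W| < arc_count W h + 12)%N -> has_K5_minor W h.
Proof.
move En : #|W| => n; elim: n W h En => // n IHn W h En hs hi n3.
move Em : (arc_count W h) => m; elim/ltn_ind: m h Em hs hi => m IHm h Em hs hi lt.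
have [n2|n2] : (n = 2%N \/ 3 <= n)%N by lia.
  have : (arc_count W h <= \sum_(u in W) 2)%N.
    by apply: leq_sum => u /(degree_ltn hi); rewrite En n2.
  rewrite sum_nat_const En; lia.
have cW v : v \in W -> #|W :\ v| = n by move=> vW; have := cardsD1 v W; rewrite vW En; lia.
(* In the first case the hypothesis survives the loss of the two arcs of an edge; in the second the
   average degree is below 6. *)
have [big|small] := leqP (6 * n.+1) (m + 9).
  have [a [b [aW bW hab]]] : exists a b, [/\ a \in W, b \in W & h a b].
    have [/exists_inP[a aW /exists_inP[b bW hab]]|] :=
      boolP [exists a in W, exists b in W, h a b]; first by exists a, b.
    rewrite negb_exists_in => /forall_inP H.
    suff : arc_count W h = 0%N by lia.
    rewrite /arc_count big1 // => a /H; rewrite negb_exists_in => /forall_inP Ha.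
    apply/eqP; rewrite cards_eq0; apply/eqP/setP => b; rewrite !inE.
    by apply/negP => /andP[/Ha/negP].
  have := arc_count_delete_edge hs hi aW bW hab => E.
  apply: (@K5_minor_mono W W h (delete_edge h a b)) => // [u v _ _ /andP[]//|].
  apply: (IHm (arc_count W (delete_edge h a b))) => //; try lia.
  - exact: delete_edge_sym.
  - by move=> u; rewrite /delete_edge hi.
have [v vW v5] : exists2 v, v \in W & (degree W h v <= 5)%N.
  by apply: exists_degree_le5; rewrite En; lia.
have [v0|v0] := posnP (degree W h v).
  apply: (@K5_minor_mono W (W :\ v) h h) => //; first exact: subD1set.
  apply: IHn => //; first exact: cW.
  by have := arc_count_delete hs hi vW; lia.
have [|] := boolP [forall x in [set w in W | h v w],
    (3 <= #|[set w in [set w in W | h v w] | h x w]|)%N].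
  by move/forall_inP; apply: K5_minor_neighborhood => //; rewrite v0 v5.
rewrite negb_forall_in => /exists_inP[u]; rewrite inE => /andP[uW hvu].
rewrite -ltnNge => t2; apply: (@K5_minor_contract W h [set v; u] v).
- exact: set21.
- by rewrite subUset !sub1set vW uW.
- exact: connected_in2.
have vu : v != u by apply: contraTneq hvu => ->; rewrite hi.
have -> : v |: W :\: [set v; u] = W :\ u.
  apply/setP => w; rewrite !inE negb_or.
  by have [->|] := eqVneq w v; rewrite ?vu ?vW.
apply: IHn => //; [exact: cW | exact: contract_sym | exact: contract_irr |].
have := arc_count_contract hs hi vW uW hvu.
suff -> : [set w in W | h v w & h u w] = [set w in [set w in W | h v w] | h u w].
  lia.
by apply/setP => w; rewrite !inE andbA.
Qed.

End Minors.

(** * Levelings, and induction by cutting along a thin level *)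

Definition is_clique (T : finType) (h : rel T) (N : {set T}) : Prop :=
  forall u v, u \in N -> v \in N -> u != v -> h u v.

Definition add_clique (T : finType) (h : rel T) (N : {set T}) : rel T :=
  fun u v => h u v || [&& u \in N, v \in N & u != v].

Definition level (T : finType) (W : {set T}) (phi : T -> nat) (i : nat) :
    {set T} := [set v in W | phi v == i].

(* These conditions say that [phi] is the distance to [level W phi 0] in the
   subgraph induced by [W]. *)
Record leveling (T : finType) (W : {set T}) (h : rel T) (phi : T -> nat) :
    Prop := Leveling {
  leveling_lip : forall u v, u \in W -> v \in W -> h u v ->
    (phi v <= (phi u).+1)%N;
  leveling_down : forall v, v \in W -> (0 < phi v)%N ->
    exists u, [/\ u \in W, h u v & phi v = (phi u).+1]
}.

Section Layers.
Variable T : finType.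
Implicit Types (W S N G : {set T}) (h : rel T) (x u v : T) (phi : T -> nat).

Lemma connected_in_add h S s x : symmetric h -> connected_in h S ->
  s \in S -> h s x -> connected_in h (x |: S).
Proof.
move=> hs Sc sS hsx.
have sub u v : u \in S -> v \in S -> connect (restrict h (x |: S)) u v.
  by move=> uS vS; apply: connect_restrictS (Sc _ _ uS vS); exact: subsetUr.
have sx : connect (restrict h (x |: S)) s x.
  by apply: connect1; rewrite /restrict !inE sS eqxx orbT hsx.
have xs : connect (restrict h (x |: S)) x s.
  by rewrite connect_restrict_sym.
move=> u v /setU1P[->|uS] /setU1P[->|vS] //.
- exact: connect_trans xs (sub _ _ sS vS).
- exact: connect_trans (sub _ _ uS sS) sx.
- exact: sub.
Qed.

Lemma add_clique_sym h N : symmetric h -> symmetric (add_clique h N).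
Proof.
by move=> hs u v; rewrite /add_clique hs andbCA (eq_sym u).
Qed.

Lemma add_clique_irr h N : irreflexive h -> irreflexive (add_clique h N).
Proof. by move=> hi u; rewrite /add_clique hi eqxx !andbF. Qed.

(** Contracting [S] into one vertex of [N] joins that vertex to the rest of [N]; as [N] has at most
    two elements, this already makes [N] a clique. *)
Lemma K5_minor_add_clique W G N S h : symmetric h -> irreflexive h ->
  N \subset G -> G \subset W -> (0 < #|N| <= 2)%N -> S \subset W ->
  [disjoint S & G] -> connected_in h S ->
  (forall u, u \in N -> exists2 s, s \in S & h s u) ->
  has_K5_minor G (add_clique h N) -> has_K5_minor W h.
Proof.
move=> hs hi NG GW /andP[N0 N2] SW SG Sc NS.
have [x xN] := card_gt0P N0.
have [s sS hsx] := NS x xN.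
have xG := subsetP NG x xN.
move=> minor; apply: (@K5_minor_contract T W h (x |: S) x); rewrite ?setU11 //.
- by rewrite subUset sub1set SW (subsetP GW).
- exact: connected_in_add hsx.
apply: (K5_minor_mono _ _ minor) => [|u v uG vG].
  apply/subsetP => u uG; rewrite !inE negb_or (subsetP GW) // andbT.
  case: eqVneq => //= _; apply/negP => uS.
  by move/pred0P/(_ u): SG; rewrite /= uS uG.
rewrite /add_clique => /orP[huv|/and3P[uN vN uv]].
  rewrite /contract huv andbT; apply: contraTneq huv => ->; by rewrite hi.
rewrite /contract uv /=.
have [ux|ux] := eqVneq u x.
  have [t tS htv] := NS v vN; apply/orP; right; apply/orP; left.
  by apply/exists_inP; exists t; rewrite // setU1r.
have [vx|vx] := eqVneq v x.
  have [t tS htu] := NS u uN; apply/orP; right; apply/orP; right.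
  by apply/exists_inP; exists t; rewrite 1?hs // setU1r.
have : (#|[set u; v; x]| <= #|N|)%N.
  by apply: subset_leq_card; rewrite !subUset !sub1set uN vN xN.
rewrite -setUA cardsU1 !inE negb_or uv ux cards2 vx => /= H.
by have := leq_trans H N2.
Qed.

Lemma component_connected h (U C : {set T}) b : symmetric h ->
  b \in C -> (forall v, v \in C -> v \in U /\ connect (restrict h U) b v) ->
  (forall v u, v \in C -> u \in U -> h v u -> u \in C) -> connected_in h C.
Proof.
move=> hs bC CU closed.
have H p x : x \in C -> path (restrict h U) x p ->
    connect (restrict h C) x (last x p).
  elim: p x => [|y p IHp] x xC //= /andP[/and3P[xU yU hxy] pth].
  have yC := closed _ _ xC yU hxy.
  by apply: connect_trans (IHp y yC pth); apply: connect1; rewrite /restrict xC yC.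
have bv v : v \in C -> connect (restrict h C) b v.
  by move=> /CU[_ /connectP[p pth ->]]; exact: H.
move=> u v uC vC; apply: connect_trans (bv v vC).
by rewrite connect_restrict_sym // bv.
Qed.

Lemma in_level W phi i v : (v \in level W phi i) = (v \in W) && (phi v == i).
Proof. by rewrite inE. Qed.

Lemma level0_neq0 W h phi v : leveling W h phi -> v \in W ->
  exists a, a \in level W phi 0.
Proof.
move=> [_ down]; elim: (phi v) {-2}v (erefl (phi v)) => {v} [|k IHk] v phiv vW.
  by exists v; rewrite inE vW phiv.
have [|u [uW _]] := down v vW; first by rewrite phiv.
by rewrite phiv => -[/esym phiu]; exact: IHk phiu uW.
Qed.

(** Every vertex descends level by level to level 0, whose vertices are pairwise adjacent. *)
Lemma lower_connected W h phi i : symmetric h -> leveling W h phi ->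
  is_clique h (level W phi 0) -> connected_in h [set v in W | (phi v < i)%N].
Proof.
move=> hs [_ down] A_clique; set L := [set v in W | _].
have toA v : v \in L -> exists2 a, a \in level W phi 0 :&: L & connect (restrict h L) v a.
  elim: (phi v) {-2}v (erefl (phi v)) => {v} [|k IHk] v phiv vL.
    by exists v; [rewrite !inE phiv in vL *; case/andP: vL => -> ->; rewrite eqxx | exact: connect0].
  have /andP[vW vi] : (v \in W) && (phi v < i)%N by rewrite inE in vL.
  have [|u [uW huv]] := down v vW; first by rewrite phiv.
  rewrite phiv => -[/esym phiu].
  have uL : u \in L by rewrite inE uW phiu; rewrite phiv in vi; exact: ltnW.
  have [a aA ua] := IHk u phiu uL; exists a => //.
  by apply: connect_trans ua; apply: connect1; rewrite /restrict vL uL hs.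
move=> u v /toA[a /setIP[aA aL] ua] /toA[b /setIP[bA bL] vb].
apply: connect_trans ua _; rewrite connect_restrict_sym //.
apply: connect_trans vb _; have [->|ba] := eqVneq b a; first exact: connect0.
by apply: connect1; rewrite /restrict bL aL A_clique.
Qed.

Lemma card_level_lt W phi k :
  #|[set v in W | (phi v < k.+1)%N]| =
  (#|[set v in W | (phi v < k)%N]| + #|level W phi k|)%N.
Proof.
rewrite -cardsUI (_ : _ :&: _ = set0) ?cards0 ?addn0.
  congr #|pred_of_set _|; apply/setP => v; rewrite !inE ltnS leq_eqVlt.
  by case: (v \in W); rewrite //= orbC.
by apply/setP => v; rewrite !inE; case: (v \in W) => //=; case: ltngtP.
Qed.

(** With [A] for level 0, the levels give [#|W| >= #|A| + 3 * (D - 1) + #|B|]. Twice this, Mader's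
    bound [arc_count W h <= 6 * #|W| - 12] and [#|A| + #|B| <= 4] add up to the claim. *)
Lemma arc_count_thick W h phi (B : {set T}) D : symmetric h -> irreflexive h ->
  ~ has_K5_minor W h -> (0 < #|level W phi 0| <= 2)%N -> B \subset W ->
  (0 < #|B| <= 2)%N -> (forall b, b \in B -> (D <= phi b)%N) -> (0 < D)%N ->
  (forall i, (0 < i < D)%N -> (3 <= #|level W phi i|)%N) ->
  (arc_count W h + 6 * D + 3 * (#|level W phi 0| + #|B|) + 2 <= 8 * #|W|)%N.
Proof.
move=> hs hi free A2 BW B2 BD D0 thick.
have low k : (0 < k <= D)%N ->
    (#|level W phi 0| + 3 * k.-1 <= #|[set v in W | (phi v < k)%N]|)%N.
  elim: k => // -[|k] IHk /= kD; rewrite card_level_lt; first by rewrite addn0 leq_addl.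
  by have := IHk (ltnW kD); have := thick k.+1 kD; move: #|_| #|_| #|_|; lia.
have cW : (#|[set v in W | (phi v < D)%N]| + #|B| <= #|W|)%N.
  rewrite -cardsUI (_ : _ :&: _ = set0) ?cards0 ?addn0.
    by apply: subset_leq_card; rewrite subUset BW andbT; apply/subsetP => v; rewrite inE => /andP[].
  apply/setP => v; rewrite !inE; apply/negP => /andP[/andP[_ vD] /BD].
  by rewrite leqNgt vD.
have {}low := low D; rewrite D0 leqnn in low; have {}low := low isT.
have [W3|W2] := leqP 3 #|W|.
  have : (arc_count W h + 12 <= 6 * #|W|)%N.
    by rewrite leqNgt; apply/negP => /(mader hs hi W3).
  by move: (arc_count W h) #|level W phi 0| #|B| #|W| #|_| low cW A2 B2 D0; lia.
have : (arc_count W h <= \sum_(u in W) #|W|.-1)%N.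
  by apply: leq_sum => u uW; have := degree_ltn hi uW; case: #|W|.
rewrite sum_nat_const.
(* Too small for Mader's theorem: then [D] is 1, both ends are singletons, and a single edge attains
   the bound. *)
have W2' : #|W| = 2.
  by move: #|level W phi 0| #|B| #|W| #|_| low cW A2 B2 D0 W2; lia.
move: #|level W phi 0| #|B| #|_| low cW A2 B2 D0; rewrite W2'; lia.
Qed.

Lemma degree_mono W W' h h' u :
  (forall v, v \in W -> h u v -> v \in W' /\ h' u v) ->
  (degree W h u <= degree W' h' u)%N.
Proof.
move=> sub; apply: subset_leq_card; apply/subsetP => v; rewrite !inE.
by case/andP=> vW /(sub v vW)[-> ->].
Qed.

(* The arcs inside [N] are counted on both sides. *)
Lemma arc_count_separation W h (C N : {set T}) : irreflexive h ->
  C \subset W -> N \subset W :\: C ->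
  (forall u v, u \in C -> v \in W -> h u v -> v \in C :|: N) ->
  (forall u v, u \in C -> v \in W -> h v u -> v \in C :|: N) ->
  (arc_count W h + #|N| * #|N|.-1 <=
     arc_count (W :\: C) (add_clique h N) + arc_count (C :|: N) (add_clique h N))%N.
Proof.
move=> hi CW NG CN CN'; set h' := add_clique h N; set G := W :\: C.
have hh' u v : h u v -> h' u v by rewrite /h' /add_clique => ->.
have NC u : u \in N -> u \notin C by move/(subsetP NG); rewrite inE => /andP[].
rewrite /arc_count (big_setID C) /= (setIidPr CW) -/G.
rewrite !(big_setID (A := G) N) (big_setID (A := C :|: N) N) /= (setIidPr NG).
rewrite (setIidPr (subsetUr C N)) setDUl setDv setU0.
have -> : C :\: N = C.
  by apply/setP => u; rewrite inE; have [/NC/negbTE->|] := boolP (u \in N); rewrite ?andbF.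
have HC : (\sum_(u in C) degree W h u <= \sum_(u in C) degree (C :|: N) h' u)%N.
  by apply: leq_sum => u uC; apply: degree_mono => v vW huv; split; [exact: (CN u) | exact: hh'].
have HG : (\sum_(u in G :\: N) degree W h u <= \sum_(u in G :\: N) degree G h' u)%N.
  apply: leq_sum => u /setDP[uG uN]; apply: degree_mono => v vW huv; split; last exact: hh'.
  rewrite inE vW andbT; apply/negP => vC.
  have uW : u \in W by move: uG; rewrite inE => /andP[].
  have := CN' v u vC uW huv; rewrite inE (negbTE uN) orbF.
  by move: uG; rewrite inE => /andP[/negbTE->].
have HN : (\sum_(u in N) degree W h u + #|N| * #|N|.-1 <=
    \sum_(u in N) degree G h' u + \sum_(u in N) degree (C :|: N) h' u)%N.
  rewrite -sum_nat_const -!big_split /=; apply: leq_sum => u uN.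
  have degW : degree W h u = (degree G h u + #|[set v in C | h u v]|)%N.
    rewrite /degree -cardsUI (_ : _ :&: _ = set0) ?cards0 ?addn0.
      congr #|pred_of_set _|; apply/setP => v; rewrite !inE -andb_orl.
      by have [/(subsetP CW)->|] := boolP (v \in C); rewrite ?orbF.
    by apply/setP => v; rewrite !inE; case: (v \in C) => //=; rewrite andbF.
  have degG : (degree G h u <= degree G h' u)%N by apply: degree_mono => v -> /hh'.
  have degC : (#|[set v in C | h u v]| + #|N|.-1 <= degree (C :|: N) h' u)%N.
    have -> : #|N|.-1 = #|N :\ u| by rewrite (cardsD1 u N) uN.
    rewrite -cardsUI (_ : _ :&: _ = set0) ?cards0 ?addn0.
      apply: subset_leq_card; apply/subsetP => v; rewrite !inE /h' /add_clique.
      case/orP=> [/andP[-> ->] //|/andP[vu vN]].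
      by rewrite uN vN (eq_sym u) vu !orbT.
    apply/setP => v; rewrite !inE; apply/negP => /andP[/andP[vC _] /andP[_ /NC]].
    by rewrite vC.
  by rewrite degW -addnA leq_add.
move: HC HG HN; rewrite -/h'; move: (_ * _)%N; lia.
Qed.

(** Both ends may be cliques of one or two vertices because the cuts of the induction become ends of
    the two sides. The terms [3 * (#|level W phi 0| + #|B|) + 2] are chosen so that the bounds of
    the sides add up without loss. *)
Lemma layer_bound D W h phi (B : {set T}) : symmetric h -> irreflexive h ->
  ~ has_K5_minor W h -> leveling W h phi ->
  is_clique h (level W phi 0) -> (#|level W phi 0| <= 2)%N ->
  B \subset W -> is_clique h B -> (0 < #|B| <= 2)%N ->
  (forall b, b \in B -> (D <= phi b)%N) -> (0 < D)%N ->
  (arc_count W h + 6 * D + 3 * (#|level W phi 0| + #|B|) + 2 <= 8 * #|W|)%N.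
Proof.
elim/ltn_ind: D W h phi B => D IHD W h phi B hs hi free lev Ac A2 BW Bc B2 BD D0.
have [b bB] : exists b, b \in B by apply/card_gt0P; case/andP: B2.
have bW := subsetP BW b bB.
have A0 : (0 < #|level W phi 0|)%N.
  by have [a aA] := level0_neq0 lev bW; apply/card_gt0P; exists a.
have [thin|thick] := boolP [exists i : 'I_D, (0 < i)%N && (#|level W phi i| <= 2)%N]; last first.
  apply: arc_count_thick => //; first by rewrite A0.
  move=> i /andP[i0 iD]; move: thick; rewrite negb_exists => /forallP/(_ (Ordinal iD)) /=.
  by rewrite i0 /= -ltnNge.
have [[i iD] /= /andP[i0 Li2]] := existsP thin.
have [lip down] := lev.
(* [C] is the component of [b] strictly above level [i], and [N] its outer neighbourhood, which lies
   in level [i]. The two sides of the cut are [W :\: C] and [C :|: N]. *)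
pose U := [set v in W | (i < phi v)%N].
pose C := [set v in U | connect (restrict h U) b v].
pose N := [set u in W :\: C | [exists v in C, h v u]].
have UW v : v \in U -> v \in W by rewrite inE => /andP[].
have CU v : v \in C -> v \in U by rewrite inE => /andP[].
have CW : C \subset W by apply/subsetP => v /CU/UW.
have Cphi v : v \in C -> (i < phi v)%N by move/CU; rewrite inE => /andP[].
have bU : b \in U by rewrite inE bW (leq_trans iD) ?BD.
have bC : b \in C by rewrite inE bU connect0.
have C_closed v u : v \in C -> u \in U -> h v u -> u \in C.
  rewrite !(in_set (fun _ => _ && connect _ _ _)) => /andP[vU bv] uU hvu.
  by rewrite uU /=; apply: connect_trans bv (connect1 _); rewrite /restrict vU uU.
have Cconn : connected_in h C.
  by apply: (@component_connected h U C b) => // v; rewrite inE => /andP[].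
have BC : B \subset C.
  apply/subsetP => v vB; have [->//|bv] := eqVneq v b.
  apply: (C_closed b) => //; last by apply: Bc => //; rewrite eq_sym.
  by rewrite inE (subsetP BW) // (leq_trans iD) ?BD.
have NP u : u \in N -> [/\ u \in W, u \notin C & exists2 v, v \in C & h v u].
  by rewrite inE in_setD => /andP[/andP[uC uW] /exists_inP uv].
have NI u v : u \in W -> u \notin C -> v \in C -> h v u -> u \in N.
  by move=> uW uC vC hvu; rewrite inE in_setD uW uC; apply/exists_inP; exists v.
have Nphi u : u \in N -> phi u = i.
  move=> /NP[uW uC [v vC hvu]]; apply/eqP; rewrite eqn_leq; apply/andP; split.
    by rewrite leqNgt; apply: contra uC => iu; apply: (C_closed v) => //; rewrite inE uW.
  rewrite -ltnS; apply: leq_trans (Cphi v vC) _; apply: lip => //; last by rewrite hs.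
  exact: (subsetP CW).
have NW : N \subset W by apply/subsetP => u /NP[].
have NL : N \subset level W phi i.
  by apply/subsetP => u uN; rewrite inE (subsetP NW) //= Nphi.
have N2 : (#|N| <= 2)%N by apply: leq_trans (subset_leq_card NL) Li2.
(* Descending from [b] level by level, one has to leave [C], which stays above level [i]; the first
   vertex outside is in [N]. *)
have N0 : (0 < #|N|)%N.
  have H k v : phi v = k -> v \in C -> (0 < #|N|)%N.
    elim: k v => [|k IHk] v phiv vC; first by have := Cphi v vC; rewrite phiv.
    have vW := subsetP CW v vC.
    have [|u [uW huv phiu]] := down v vW; first by rewrite phiv.
    have [uC|uC] := boolP (u \in C).
      by apply: (IHk u) => //; move: phiu; rewrite phiv => -[].
    by apply/card_gt0P; exists u; apply: (NI u v) => //; rewrite hs.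
  exact: (H _ b).
have NC : N \subset W :\: C.
  by apply/subsetP => u /NP[uW uC _]; rewrite inE uC.
pose h' := add_clique h N.
have h's : symmetric h' by exact: add_clique_sym.
have h'i : irreflexive h' by exact: add_clique_irr.
have h'N : is_clique h' N by move=> u v uN vN uv; rewrite /h' /add_clique uN vN uv orbT.
have N12 : (0 < #|N| <= 2)%N by rewrite N0.
have h'lip u v : u \in W -> v \in W -> h' u v -> (phi v <= (phi u).+1)%N.
  move=> uW vW /orP[|/and3P[uN vN _]]; first exact: lip.
  by rewrite !Nphi.
have hh' u v : h u v -> h' u v by rewrite /h' /add_clique => ->.
(* Contracting the connected set [C], which is adjacent to all of [N], realizes the clique on
   [N]. *)
have free1 : ~ has_K5_minor (W :\: C) h'.
  move=> minor; apply: free; apply: (K5_minor_add_clique _ _ NC _ _ CW _ Cconn _ minor) => //.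
  - exact: subsetDl.
  - by rewrite disjoint_sym disjoints_subset; apply/subsetP => v; rewrite !inE => /andP[].
  - by move=> u /NP[].
have lev1 : leveling (W :\: C) h' phi.
  split=> [u v /setDP[uW _] /setDP[vW _]|v /setDP[vW vC] v0]; first exact: h'lip.
  have [u [uW huv phiu]] := down v vW v0; exists u; split=> //; last exact: hh'.
  rewrite inE uW andbT; apply: contra vC => uC; apply: (C_closed u) => //.
  by rewrite inE vW phiu; have := Cphi u uC; exact: leqW.
have A1 : level (W :\: C) phi 0 = level W phi 0.
  apply/setP => v; rewrite !in_level in_setD.
  have [vC|//] := boolP (v \in C); apply/esym/negbTE; rewrite negb_and -lt0n.
  by rewrite (leq_ltn_trans _ (Cphi v vC)) ?orbT.
have bound1 : (arc_count (W :\: C) h' + 6 * i +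
    3 * (#|level W phi 0| + #|N|) + 2 <= 8 * #|W :\: C|)%N.
  rewrite -A1; apply: IHD => //; rewrite ?A1 //.
  - by move=> u v uA vA uv; apply/hh'/Ac.
  - by move=> u /Nphi->.
(* On this side the levels below [i] are contracted: each vertex of [N] has a neighbour one level
   down. *)
have free2 : ~ has_K5_minor (C :|: N) h'.
  move=> minor; apply: free.
  apply: (@K5_minor_add_clique W (C :|: N) N [set v in W | (phi v < i)%N] h) => //.
  - exact: subsetUr.
  - by rewrite subUset CW NW.
  - by apply/subsetP => v; rewrite inE => /andP[].
  - apply/pred0P => v /=; rewrite in_set in_setU.
    apply/negP => /andP[/andP[_ vi] /orP[/Cphi|/Nphi]]; first by rewrite ltnNge (ltnW vi).
    by move=> vi'; rewrite vi' ltnn in vi.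
  - exact: lower_connected.
  - move=> u uN; have [|v [vW hvu phiv]] := down u (subsetP NW u uN); first by rewrite Nphi.
    exists v => //.
    by rewrite inE vW -(Nphi u uN) phiv /= ltnSn.
(* The shift makes [N] the new level 0; the subtraction does not truncate on [C :|: N], where [phi]
   is at least [i]. *)
pose psi v := (phi v - i)%N.
have A2' : level (C :|: N) psi 0 = N.
  apply/setP => v; rewrite in_level in_setU subn_eq0.
  have [vC|vC] := boolP (v \in C).
    have := Cphi v vC; rewrite ltnNge => /negbTE-> /=; apply/esym/negbTE/negP.
    by case/NP; rewrite vC.
  by have [/Nphi->|] := boolP (v \in N); rewrite /= ?leqnn.
have psiW v : v \in C :|: N -> v \in W /\ (i <= phi v)%N.
  by case/setUP=> [vC|vN]; [rewrite (subsetP CW) // ltnW ?Cphi | rewrite (subsetP NW) // Nphi].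
have lev2 : leveling (C :|: N) h' psi.
  split=> [u v /psiW[uW iu] /psiW[vW iv] huv|v vCN].
    by rewrite /psi -subSn // leq_sub2r // h'lip.
  rewrite /psi subn_gt0 => iv; have [vW _] := psiW v vCN.
  have vC : v \in C by case/setUP: vCN => // /Nphi phiv; rewrite phiv ltnn in iv.
  have [u [uW huv phiv]] := down v vW (leq_ltn_trans (leq0n i) iv).
  exists u; rewrite phiv subSn; last by rewrite phiv in iv.
  split=> //; last exact: hh'.
  by rewrite inE; have [//|uC] := boolP (u \in C); apply: (NI u v); rewrite // hs.
have bound2 : (arc_count (C :|: N) h' + 6 * (D - i) +
    3 * (#|N| + #|B|) + 2 <= 8 * #|C :|: N|)%N.
  rewrite -{2}A2'; apply: (IHD (D - i)%N) => //; rewrite ?A2' //;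
    first by rewrite ltn_subrL i0 D0.
  - exact: subset_trans BC (subsetUl _ _).
  - by move=> u v uB vB uv; apply/hh'/Bc.
  - by move=> u uB; apply: leq_sub2r; exact: BD.
  - by rewrite subn_gt0.
have sep : (arc_count W h + #|N| * #|N|.-1 <=
     arc_count (W :\: C) h' + arc_count (C :|: N) h')%N.
  apply: arc_count_separation => // u v uC vW huv; rewrite in_setU.
    by have [//|vC] := boolP (v \in C); apply: (NI v u).
  by have [//|vC] := boolP (v \in C); apply: (NI v u) => //; rewrite hs.
have c1 : (#|W :\: C| + #|C| = #|W|)%N by rewrite addnC -(cardsID C W) (setIidPr CW).
have c2 : (#|C :|: N| = #|C| + #|N|)%N.
  rewrite -cardsUI (_ : C :&: N = set0) ?cards0 ?addn0 //.
  by apply/setP => v; rewrite in_setI in_set0; apply/negP => /andP[vC /NP[_]]; rewrite vC.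
(* With [k] for [#|N|], adding the two bounds gives the claim with [8 * #|W| + (k - 1) * (2 - k)] on
   the right, and the extra term vanishes for both values. *)
have k12 : #|N| = 1 \/ #|N| = 2 by clear -N0 N2; lia.
move: bound1 bound2 sep c1 c2 iD.
move: (arc_count _ _) (arc_count _ _) (arc_count _ _) #|W :\: C| #|W| #|C :|: N| #|C|.
move: #|level W phi 0| #|B|; case: k12 => ->; clear; lia.
Qed.

End Layers.

(** * L-shaped steps in the real plane *)

Section Plane.
Variable R : realType.
Implicit Types (p q a b c d : R * R) (delta : R).

(** Breaking ties by the other coordinate makes any two distinct points comparable in both
    directions, so that no general position has to be arranged. *)
Definition lexi_lt (x1 x2 y1 y2 : R) : bool := (x1 < y1) || (x1 == y1) && (x2 < y2).
Definition abscissa_lt : rel (R * R) := fun p q => lexi_lt p.1 p.2 q.1 q.2.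
Definition ordinate_lt : rel (R * R) := fun p q => lexi_lt p.2 p.1 q.2 q.1.

Definition close delta : rel (R * R) :=
  fun p q => (`|p.1 - q.1| < delta) && (`|p.2 - q.2| < delta).

Lemma closeP delta p q : reflect (ball p delta q) (close delta p q).
Proof.
have E (x y : R) : ball x delta y = (`|x - y| < delta) :> Prop by rewrite -ball_normE.
by rewrite /ball /= /prod_ball !E; exact: andP.
Qed.

Lemma close_refl delta p : 0 < delta -> close delta p p.
Proof. by move=> d0; rewrite /close !subrr normr0 d0. Qed.

Lemma lexi_lt_anti (x1 x2 y1 y2 : R) : (x1, x2) != (y1, y2) ->
  lexi_lt y1 y2 x1 x2 = ~~ lexi_lt x1 x2 y1 y2.
Proof.
rewrite xpair_eqE negb_and /lexi_lt => xy.
by case: (ltgtP x1 y1) xy => //= _; case: (ltgtP x2 y2).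
Qed.

Lemma abscissa_lt_anti p q : p != q -> abscissa_lt q p = ~~ abscissa_lt p q.
Proof. by case: p q => [p1 p2] [q1 q2]; exact: lexi_lt_anti. Qed.

Lemma ordinate_lt_anti p q : p != q -> ordinate_lt q p = ~~ ordinate_lt p q.
Proof.
case: p q => [p1 p2] [q1 q2] pq; apply: lexi_lt_anti; apply: contra pq.
by rewrite !xpair_eqE andbC.
Qed.

(** If exactly one of two points precedes the third lexicographically, then [z1] lies weakly between
    [x1] and [y1]. *)
Lemma lexi_lt_between (x1 x2 y1 y2 z1 z2 : R) :
  lexi_lt x1 x2 z1 z2 (+) lexi_lt y1 y2 z1 z2 ->
  `|x1 - z1| <= `|x1 - y1| /\ `|y1 - z1| <= `|x1 - y1|.
Proof.
have H u1 u2 v1 v2 : lexi_lt u1 u2 z1 z2 -> ~~ lexi_lt v1 v2 z1 z2 -> u1 <= z1 <= v1.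
  rewrite /lexi_lt negb_or => /orP uz /andP[vz _]; rewrite (leNgt z1) vz andbT.
  by case: uz => [/ltW|/andP[/eqP->]].
have [xz|xz] := boolP (lexi_lt x1 x2 z1 z2);
  have [yz|yz] := boolP (lexi_lt y1 y2 z1 z2) => // _.
  have /andP[? ?] := H _ _ _ _ xz yz.
  by rewrite (ler0_norm (_ : x1 - z1 <= 0)) ?(ler0_norm (_ : x1 - y1 <= 0))
    ?(ger0_norm (_ : 0 <= y1 - z1)); first (split; lra); lra.
have /andP[? ?] := H _ _ _ _ yz xz.
by rewrite (ger0_norm (_ : 0 <= x1 - z1)) ?(ger0_norm (_ : 0 <= x1 - y1))
  ?(ler0_norm (_ : y1 - z1 <= 0)); first (split; lra); lra.
Qed.

Lemma lexi_lt_between' (x1 x2 y1 y2 z1 z2 : R) :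
  lexi_lt z1 z2 x1 x2 (+) lexi_lt z1 z2 y1 y2 ->
  `|x1 - z1| <= `|x1 - y1| /\ `|y1 - z1| <= `|x1 - y1|.
Proof.
have H u1 u2 v1 v2 : lexi_lt z1 z2 u1 u2 -> ~~ lexi_lt z1 z2 v1 v2 -> v1 <= z1 <= u1.
  rewrite /lexi_lt negb_or => /orP uz /andP[vz _]; rewrite leNgt vz /=.
  by case: uz => [/ltW|/andP[/eqP->]].
have [xz|xz] := boolP (lexi_lt z1 z2 x1 x2);
  have [yz|yz] := boolP (lexi_lt z1 z2 y1 y2) => // _.
  have /andP[? ?] := H _ _ _ _ xz yz.
  by rewrite (ger0_norm (_ : 0 <= x1 - z1)) ?(ger0_norm (_ : 0 <= x1 - y1))
    ?(ler0_norm (_ : y1 - z1 <= 0)); first (split; lra); lra.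
have /andP[? ?] := H _ _ _ _ yz xz.
by rewrite (ler0_norm (_ : x1 - z1 <= 0)) ?(ler0_norm (_ : x1 - y1 <= 0))
    ?(ger0_norm (_ : 0 <= y1 - z1)); first (split; lra); lra.
Qed.

(** If the horizontal part of [a b] meets the vertical part of [c d], the abscissa of [d] lies
    between those of [a] and [b], and the ordinate of [a] between those of [c] and [d]; so [a] and
    [d] are close. The other kind of crossing gives [b] and [c]. *)
Lemma step_crossing_close delta a b c d :
  close delta a b -> close delta c d ->
  step_crossing abscissa_lt ordinate_lt a b c d ->
  close delta a d || close delta b c.
Proof.
move=> /andP[ab1 ab2] /andP[cd1 cd2]; rewrite /step_crossing.
set s := _ && _; set t := _ && _ => st.
have : s || t by move: st; case: s t => [] [].
case/orP => /andP[].
  move=> /lexi_lt_between[H _] /lexi_lt_between'[_ H'].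
  rewrite /close (le_lt_trans H ab1) /=.
  by rewrite distrC (le_lt_trans H' cd2).
move=> /lexi_lt_between'[H _] /lexi_lt_between[_ H'].
by rewrite /close (distrC b.1) (le_lt_trans H cd1) /= (le_lt_trans H' ab2) orbT.
Qed.

Lemma path_crossing_far delta a (s : seq (R * R)) c (t : seq (R * R)) :
  path (close delta) a s -> path (close delta) c t ->
  (forall x y, x \in a :: s -> y \in c :: t -> ~~ close delta x y) ->
  path_crossing abscissa_lt ordinate_lt a s c t = false.
Proof.
move=> as_ ; elim: t c => //= d t IHt c /andP[cd dt] far.
rewrite IHt // => [|x y xs yt]; last by apply: far; rewrite // inE yt orbT.
rewrite addbF; have {IHt dt}far1 x : x \in a :: s -> ~~ close delta x c /\ ~~ close delta x d.
  by move=> xs; split; apply: far; rewrite // !inE eqxx ?orbT.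
elim: s a as_ far1 {far} => //= b s IHs a /andP[ab bs] far1.
rewrite IHs // => [|x xs]; last by apply: far1; rewrite inE xs orbT.
rewrite addbF; apply/negP => /(step_crossing_close ab cd)/orP[].
  by have [_ /negbTE->] := far1 a (mem_head _ _).
by have [|/negbTE->] := far1 b; rewrite // !inE eqxx orbT.
Qed.

End Plane.

(** * Fine chains of points along arcs *)

Section Arcs.
Variable R : realType.
Implicit Types (f g : R -> R * R) (delta : R).

Definition chain delta (Q : R * R -> Prop) (a b : R * R) : Prop :=
  exists p, [/\ path (close delta) a p, last a p = b & forall x, x \in a :: p -> Q x].

Lemma chain_trans delta Q a b c : chain delta Q a b -> chain delta Q b c ->
  chain delta Q a c.
Proof.
move=> [p [ap pb pQ]] [q [bq qc qQ]]; exists (p ++ q); split.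
- by rewrite cat_path ap pb.
- by rewrite last_cat pb.
- move=> x; rewrite -cat_cons mem_cat => /orP[/pQ//|xq].
  by apply: qQ; rewrite inE xq orbT.
Qed.

Lemma chain_mono delta (Q Q' : R * R -> Prop) a b : (forall x, Q x -> Q' x) ->
  chain delta Q a b -> chain delta Q' a b.
Proof. by move=> sub [p [ap pb pQ]]; exists p; split=> // x /pQ/sub. Qed.

Lemma arc_continuous_at f t : {within `[0%R, 1%R]%classic, continuous f}%classic ->
  t \in `[0, 1] -> forall eps, 0 < eps ->
  exists2 r, 0 < r & forall s, s \in `[0, 1] -> `|s - t| < r -> close eps (f s) (f t).
Proof.
move=> /subspace_continuousP cf t01 eps eps0.
have := cf t t01 _ (nbhsx_ballx (f t) eps eps0).
rewrite /nbhs /= /within /= => /nbhs_ballP[r /= r0 rP]; exists r => // s s01 st.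
by apply/closeP/ball_sym; apply: rP => //=; rewrite distrC.
Qed.

(** Heine's theorem, from the near-covering form of compactness of the unit interval. *)
Lemma arc_uniform f eps : {within `[0%R, 1%R]%classic, continuous f}%classic -> 0 < eps ->
  exists2 r, 0 < r & forall s t, s \in `[0, 1] -> t \in `[0, 1] -> `|s - t| < r ->
    close eps (f s) (f t).
Proof.
move=> cf eps0.
have /compact_near_coveringP cpt := @segment_compact R 0 1.
pose P (r : R) (t : R) := t \in `[0, 1] ->
  forall s, s \in `[0, 1] -> `|s - t| < r -> close eps (f s) (f t).
have cover : \forall r \near (0%R^'+)%classic, (`[0%R, 1%R] `<=` P r)%classic.
  apply: cpt => t t01.
  have e20 : 0 < eps / 2 by rewrite divr_gt0.
  have [r r0 rP] := arc_continuous_at cf t01 e20.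
  have r20 : 0 < r / 2 by rewrite divr_gt0.
  exists (ball t (r / 2), [set x | 0 < x < r / 2]%classic) => /=.
    split; first exact: nbhsx_ballx.
    by apply: filterS2 (nbhs_right_gt 0) (nbhs_right_lt r20) => e /= -> ->.
  move=> [t' d] [/= + /andP[d0 dr]]; rewrite -ball_normE /= => tt' t'01 s s01 st'.
  apply/closeP; rewrite (splitr eps); apply: (@ball_triangle _ _ (f t)).
    apply/closeP; apply: rP => //; rewrite -(subrK t' s) -addrA (le_lt_trans (ler_normD _ _)) //.
    by rewrite (splitr r) ltrD // ?(lt_trans st') // distrC.
  apply/ball_sym/closeP; apply: rP => //; rewrite distrC (lt_trans tt') //; lra.
have : \forall r \near (0%R^'+)%classic, (`[0%R, 1%R] `<=` P r)%classic /\ 0 < r.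
  by apply: filterI; [exact: cover | exact: nbhs_right_gt].
move=> /(@filter_ex _ _ (at_right_proper_filter _))[r [rP r0]].
by exists r => // s t s01 t01; apply: rP.
Qed.

Lemma path_iota (T : Type) (e : rel T) (x : nat -> T) m n :
  (forall i, (i < n)%N -> e (x (m + i)%N) (x (m + i).+1)) ->
  path e (x m) [seq x i | i <- iota m.+1 n].
Proof.
elim: n m => //= n IHn m H; apply/andP; split; first by have := H 0%N isT; rewrite addn0.
by apply: IHn => i i_n; rewrite addSnnS; apply: (H i.+1).
Qed.

(** The interval from [s] to [t] is divided into [n.+1] equal parts, shorter than the radius of
    uniform continuity. *)
Lemma arc_chain f s t delta : {within `[0%R, 1%R]%classic, continuous f}%classic ->
  0 < delta -> s \in `[0, 1] -> t \in `[0, 1] ->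
  chain delta (fun x => exists2 u, u \in `[0, 1] & x = f u) (f s) (f t).
Proof.
move=> cf delta0 s01 t01; have [r r0 rP] := arc_uniform cf delta0.
have [n nr] : exists n, n.+1%:R^-1 < r.
  by exists (Num.truncn r^-1); rewrite invf_plt ?posrE // truncnS_gt.
pose u i : R := s + (t - s) * (i%:R / n.+1%:R).
have u01 i : (i <= n.+1)%N -> u i \in `[0, 1].
  move=> i_n; have : 0 <= (i%:R / n.+1%:R : R) <= 1.
    by rewrite divr_ge0 //= ler_pdivrMr ?ltr0n // mul1r ler_nat.
  rewrite /u !in_itv /= in s01 t01 *; move: (_ / _) => z; nra.
exists [seq f (u i) | i <- iota 1 n.+1]; split.
- rewrite (_ : f s = f (u 0%N)); last by rewrite /u mul0r mulr0 addr0.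
  apply: (path_iota (x := fun i => f (u i))) => i i_n; apply: rP; try by apply: u01; lia.
  apply: le_lt_trans nr; rewrite /u add0n.
  have -> : s + (t - s) * (i%:R / n.+1%:R) - (s + (t - s) * (i.+1%:R / n.+1%:R))
      = (s - t) * n.+1%:R^-1.
    have N0 : (n.+1%:R : R) != 0 by rewrite pnatr_eq0.
    by rewrite -[i.+1%:R]natr1; move: (n.+1%:R : R) N0 => N N0; field.
  rewrite normrM (ger0_norm (_ : 0 <= n.+1%:R^-1)) ?invr_ge0 //.
  rewrite ler_piMl ?invr_ge0 //; rewrite !in_itv /= in s01 t01.
  by rewrite ler_norml; lra.
- rewrite -nth_last size_map size_iota (nth_map 0%N) ?size_iota // nth_iota // add1n /=.
  by congr f; rewrite /u divff ?pnatr_eq0 // mulr1 addrC subrK.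
- move=> x; rewrite inE => /orP[/eqP->|/mapP[i]]; first by exists s.
  by rewrite mem_iota => i_n ->; exists (u i) => //; apply: u01; lia.
Qed.

(** The image of [f] is compact and that of [g] closed. The form [\near 0^'+] allows finitely many
    pairs of arcs to be treated with one [delta]. *)
Lemma arcs_separated f g : {within `[0%R, 1%R]%classic, continuous f}%classic ->
  {within `[0%R, 1%R]%classic, continuous g}%classic ->
  (forall s t, s \in `[0, 1] -> t \in `[0, 1] -> f s <> g t) ->
  \forall delta \near (0%R^'+)%classic, forall s t, s \in `[0, 1] -> t \in `[0, 1] ->
    ~~ close delta (f s) (g t).
Proof.
move=> cf cg fg.
have cK := @segment_compact R 0 1.
have /compact_near_coveringP cptf := continuous_compact cf cK.
have clg := compact_closed (@norm_hausdorff _ _) (continuous_compact cg cK).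
pose P (delta : R) (x : R * R) := forall t, t \in `[0, 1] -> ~~ close delta x (g t).
suff : \forall delta \near (0%R^'+)%classic, ([set f x | x in `[0%R, 1%R]] `<=` P delta)%classic.
  by apply: filterS => delta sub s t s01; apply: sub; exists s.
apply: cptf => x [s s01 <-].
have : nbhs (f s) (~` [set g x | x in `[0%R, 1%R]])%classic.
  apply: open_nbhs_nbhs; split; first exact: closed_openC.
  by move=> [t t01 /esym]; exact: fg.
move=> /nbhs_ballP[r /= r0 rP].
have r20 : 0 < r / 2 by rewrite divr_gt0.
exists (ball (f s) (r / 2), [set x | 0 < x < r / 2]%classic) => /=.
  split; first exact: nbhsx_ballx.
  by apply: filterS2 (nbhs_right_gt 0) (nbhs_right_lt r20) => e /= -> ->.
move=> [y d] [/= By /andP[d0 dr]] t t01; apply/closeP => Byg.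
apply: (rP (g t)); last by exists t.
rewrite (splitr r); apply: ball_triangle By _.
by apply: le_ball Byg; exact: ltW.
Qed.

End Arcs.

(** * Absence of K5 minors in drawn graphs *)

Section PlanarGraphs.
Variables (R : realType) (T : finType) (e : rel T).
Variables (pos : T -> R * R) (arc : {set T} -> R -> R * R).
Hypothesis drawing : plane_drawing e pos arc.

Lemma edgesP E : reflect (exists u v, e u v /\ E = [set u; v]) (E \in edges e).
Proof.
apply: (iffP imsetP) => [[[u v]]|[u [v [uv ->]]]].
  by rewrite inE /= => uv ->; exists u, v.
by exists (u, v); rewrite // inE.
Qed.

Lemma arc_end E t : E \in edges e -> t = 0 \/ t = 1 ->
  exists2 v, v \in E & arc E t = pos v.
Proof.
move=> /(drawing_arc_ends drawing) ends t01.
have : [set arc E 0; arc E 1]%classic (arc E t) by case: t01 => ->; [left | right].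
by rewrite ends => -[v vE <-]; exists v.
Qed.

Lemma vertex_on_arc E v : E \in edges e -> v \in E ->
  exists2 t, t \in `[0, 1] & arc E t = pos v.
Proof.
move=> /(drawing_arc_ends drawing) ends vE.
have : (pos @` [set` E])%classic (pos v) by exists v.
rewrite -ends => -[->|->]; [exists 0|exists 1] => //; rewrite in_itv /=; lra.
Qed.

Lemma arcs_disjoint E F s t : E \in edges e -> F \in edges e -> [disjoint E & F] ->
  s \in `[0, 1] -> t \in `[0, 1] -> arc E s <> arc F t.
Proof.
move=> Ee Fe EF.
have io (r : R) : r \in `[0, 1] -> (r \in `]0, 1[) \/ (r = 0 \/ r = 1).
  rewrite !in_itv /= => /andP[r0 r1].
  have [->|r0'] := eqVneq r 0; first by right; left.
  have [->|r1'] := eqVneq r 1; first by right; right.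
  by left; rewrite !lt_neqAle r0 r1 eq_sym r0' r1'.
have EnF : E != F.
  have [u [v [_ uE]]] := edgesP _ Ee; apply: contraTneq EF => <-.
  by apply/pred0Pn; exists u; rewrite /= uE set21.
move=> /io[s01|/(arc_end Ee)[u uE ->]] /io[t01|/(arc_end Fe)[v vF ->]].
- exact: (drawing_arc_disjoint drawing).
- exact: (drawing_arc_vertex drawing).
- by move/esym; exact: (drawing_arc_vertex drawing).
- by move/(drawing_pos_inj drawing) => uv; move/pred0P/(_ u): EF; rewrite /= uE uv vF.
Qed.

Definition on_arcs (S : {set T}) (x : R * R) : Prop :=
  exists E, [/\ E \in edges e, E \subset S & exists2 t, t \in `[0, 1] & x = arc E t].

Lemma edge_chain delta (S : {set T}) u v : 0 < delta -> u \in S -> v \in S -> e u v ->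
  chain delta (on_arcs S) (pos u) (pos v).
Proof.
move=> d0 uS vS uv; set E := [set u; v].
have Ee : E \in edges e by apply/edgesP; exists u, v.
have [s s01 <-] := vertex_on_arc Ee (set21 u v).
have [t t01 <-] := vertex_on_arc Ee (set22 u v).
apply: chain_mono (arc_chain (drawing_arc_continuous drawing Ee) d0 s01 t01).
by move=> x xE; exists E; rewrite subUset !sub1set uS vS.
Qed.

(** The chains of the edges of a walk are concatenated. Distinct ends ensure that the walk has an
    edge, since the point of an isolated vertex lies on no arc. *)
Lemma connect_chain delta (S : {set T}) u v : 0 < delta -> u != v ->
  connect (restrict e S) u v -> chain delta (on_arcs S) (pos u) (pos v).
Proof.
move=> d0 uv /connectP[p pth def_v].
elim: p u pth def_v uv => [|w p IHp] u /=; first by move=> _ ->; rewrite eqxx.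
move=> /andP[/and3P[uS wS uw] pth] def_v uv.
have uw_chain := edge_chain d0 uS wS uw.
have [<-//|wv] := eqVneq w v.
exact: chain_trans uw_chain (IHp w pth def_v wv).
Qed.

(** Representatives of the branch sets are joined by chains through the two branch sets concerned.
    Chains of disjoint pairs use disjoint edges and are thus far apart, so they have crossing parity
    0, against [K5_parity]. *)
Lemma drawing_no_K5_minor (W : {set T}) : ~ has_K5_minor W e.
Proof.
move=> [B [_ B0 Bc Bd Be]].
pose separates (delta : R) (EF : {set T} * {set T}) :=
  EF.1 \in edges e -> EF.2 \in edges e -> [disjoint EF.1 & EF.2] ->
  forall s t, s \in `[0, 1] -> t \in `[0, 1] ->
    ~~ close delta (arc EF.1 s) (arc EF.2 t).
have : \forall delta \near (0%R^'+)%classic, (forall EF, separates delta EF) /\ 0 < delta.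
  apply: filterI; last exact: nbhs_right_gt.
  apply: (@filter_forall _ _ (fun EF delta => separates delta EF) _
    (@filter_filter _ _ (at_right_proper_filter _))) => -[E F]; rewrite /separates /=.
  have [Ee|Ee] := boolP (E \in edges e); last by apply: nearW.
  have [Fe|Fe] := boolP (F \in edges e); last by apply: nearW.
  have [EF|EF] := boolP [disjoint E & F]; last by apply: nearW.
  have := arcs_separated (drawing_arc_continuous drawing Ee)
    (drawing_arc_continuous drawing Fe) (fun s t => @arcs_disjoint E F s t Ee Fe EF).
  by apply: filterS => delta sep _ _ _.
move=> /(@filter_ex _ _ (at_right_proper_filter _))[delta [sep d0]].
have [c cB] : exists c : 'I_5 -> T, forall i, c i \in B i.
  have /choice[c cB] : forall i, exists v, v \in B i by move=> i; exact/set0Pn/B0.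
  by exists c.
have c_neq i j : i != j -> c i != c j.
  by move=> ij; apply: contraTneq (Bd i j ij) => cij;
    apply/pred0Pn; exists (c i); rewrite /= cB cij cB.
(* The condition stands under the existential so that [choice] yields a path for every pair; on the
   diagonal it is empty. *)
have Pex (ij : 'I_5 * 'I_5) : exists p, ij.1 != ij.2 ->
    [/\ path (close delta) (pos (c ij.1)) p, last (pos (c ij.1)) p = pos (c ij.2) &
        forall x, x \in pos (c ij.1) :: p -> on_arcs (B ij.1 :|: B ij.2) x].
  case: ij => i j /=; have [//|ij] := eqVneq i j; first by exists [::].
  suff [p pP] : chain delta (on_arcs (B i :|: B j)) (pos (c i)) (pos (c j)) by exists p.
  apply: connect_chain => //; first exact: c_neq.
  have [u [v [uB vB uv]]] := Be i j ij.
  apply: connect_trans (connect_restrictS (subsetUl _ _) (Bc i _ _ (cB i) uB)) _.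
  apply: connect_trans (connect_restrictS (subsetUr _ _) (Bc j _ _ vB (cB j))).
  by apply: connect1; rewrite /restrict !inE uB vB uv orbT.
have [P PP] := choice Pex.
pose X : rel 'I_5 := fun i j => abscissa_lt (pos (c i)) (pos (c j)).
pose w i j k := winding (@abscissa_lt R) (@ordinate_lt R) (pos (c i)) (P (i, j)) (pos (c k)).
apply: (@K5_parity w X) => [i j ij|i j k l].
  by apply: abscissa_lt_anti; rewrite (inj_eq (drawing_pos_inj drawing)) c_neq.
rewrite /= !inE !negb_or => /and4P[/and3P[ij ik il] /andP[jk jl] kl _].
have [Pij Lij Qij] := PP (i, j) ij; have [Pkl Lkl Qkl] := PP (k, l) kl.
rewrite /= in Pij Lij Qij Pkl Lkl Qkl.
have far x y : x \in pos (c i) :: P (i, j) -> y \in pos (c k) :: P (k, l) ->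
    ~~ close delta x y.
  move=> /Qij[E [Ee ES [s s01 ->]]] /Qkl[F [Fe FS [t t01 ->]]].
  apply: (sep (E, F)) => //=; apply: disjointWl ES _; apply: disjointWr FS _.
  rewrite disjoint_sym -setI_eq0; apply/eqP/setP => z; rewrite !inE.
  have D a b : a != b -> z \in B a -> z \in B b = false.
    by move=> ab za; apply/negP => zb; move/pred0P/(_ z): (Bd a b ab); rewrite /= za zb.
  apply/negP => /andP[/orP[zk|zl] /orP[zi|zj]].
  - by rewrite (D i k) in zk.
  - by rewrite (D j k) in zk.
  - by rewrite (D i l) in zl.
  - by rewrite (D j l) in zl.
(* A common point would be close to itself; this provides the side conditions of
   [path_crossingE]. *)
have notin x : x \in pos (c i) :: P (i, j) -> x \notin pos (c k) :: P (k, l).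
  by move=> xij; apply/negP => /(far _ _ xij); rewrite close_refl.
have := path_crossing_far Pij Pkl far.
rewrite path_crossingE ?Lij ?Lkl //.
- exact: abscissa_lt_anti.
- exact: ordinate_lt_anti.
- by apply: notin; exact: mem_head.
- by rewrite -Lij; apply: notin; exact: mem_last.
Qed.

End PlanarGraphs.

(** * Graph distance as a leveling, and the number of edges *)

Section Distance.
Variables (T : finType) (e : rel T).
Implicit Types (x y u v : T) (p : seq T).

Lemma has_path_size x p : path e x p -> uniq (x :: p) ->
  (size p < #|T|)%N /\ has_path e x (last x p) (size p).
Proof.
move=> xp up; split; first by have := max_card (mem (x :: p)); rewrite (card_uniqP up).
by apply/existsP; exists (in_tuple p); rewrite xp up eqxx.
Qed.

(** Since [dist] searches simple paths only, the walk is first shortened to one, whose length lies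
    in the search range. *)
Lemma dist_le x p : path e x p -> (dist e x (last x p) <= size p)%N.
Proof.
case/shortenP => q xq uq sub.
have qp : (size q <= size p)%N.
  by apply: uniq_leq_size; [case/andP: uq | exact: sub].
apply: leq_trans qp; have [qT hq] := has_path_size xq uq.
rewrite leqNgt; apply/negP => /(before_find 0%N).
by rewrite nth_iota // add0n hq.
Qed.

Lemma dist_path x y : connect e x y ->
  exists p, [/\ path e x p, last x p = y & size p = dist e x y].
Proof.
move=> /connectP[p0 + ->]; case/shortenP => p xp up _.
have [pT hp] := has_path_size xp up.
have has : has (has_path e x (last x p)) (iota 0 #|T|).
  by apply/hasP; exists (size p); rewrite ?mem_iota.
have := nth_find 0%N has; rewrite nth_iota ?add0n; last first.
  by move: has; rewrite has_find size_iota.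
by case/existsP=> q /and3P[xq _ /eqP lq]; exists q; rewrite size_tuple.
Qed.

(** The vertex before [v] on a shortest path from [x] is one level below [v]. *)
Lemma dist_leveling x : symmetric e -> connected_graph e -> leveling [set: T] e (dist e x).
Proof.
move=> e_sym /andP[_ /forallP conn].
have {}conn v : connect e x v by move/forallP: (conn x).
have lip u v : e u v -> (dist e x v <= (dist e x u).+1)%N.
  move=> uv; have [p [xp pu <-]] := dist_path (conn u).
  by have := @dist_le x (rcons p v); rewrite rcons_path xp pu uv last_rcons size_rcons; exact.
split=> [u v _ _|v _ v0]; first exact: lip.
have [p [xp pv pd]] := dist_path (conn v).
case/lastP: p xp pv pd => [|p w]; first by move=> _ _ /= /esym d0; rewrite d0 in v0.
rewrite rcons_path last_rcons size_rcons => /andP[xp uw] wv pd; rewrite {w}wv in uw.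
exists (last x p); split=> //; apply/eqP; rewrite eqn_leq lip //=.
by rewrite -pd ltnS dist_le.
Qed.

Lemma dist_level0 x : connected_graph e -> level [set: T] (dist e x) 0 = [set x].
Proof.
move=> /andP[_ /forallP conn]; apply/setP => v; rewrite !inE /=.
apply/eqP/eqP => [d0|->]; last by apply/eqP; rewrite -leqn0; exact: (@dist_le x [::]).
have [p [_ lp pd]] := dist_path (forallP (conn x) v).
by move: pd lp; rewrite d0 => /size0nil->.
Qed.

(** Each edge is the image of two distinct arcs, one in each direction. *)
Lemma card_edges_le : symmetric e -> irreflexive e ->
  (2 * #|edges e| <= arc_count [set: T] e)%N.
Proof.
move=> e_sym e_irr; pose A := [set p : T * T | e p.1 p.2].
have -> : arc_count [set: T] e = #|A|.
  rewrite -sum1_card /arc_count (eq_bigl xpredT) => [|u]; last by rewrite inE.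
  under eq_bigr do rewrite /degree -sum1_card.
  rewrite pair_big_dep /=; by apply: eq_bigl => uv; rewrite !inE.
rewrite /edges -/A -[#|A|]sum1_card (partition_big_imset (fun uv => [set uv.1; uv.2])) /=.
rewrite mulnC -sum_nat_const; apply: leq_sum => E /imsetP[[u v]]; rewrite inE /= => uv ->.
rewrite sum1dep_card (_ : 2%N = #|[set (u, v); (v, u)]|).
  apply: subset_leq_card; apply/subsetP => uv' /set2P[]->; rewrite !inE /= ?uv ?eqxx //.
  by rewrite e_sym uv setUC eqxx.
rewrite cards2 xpair_eqE (_ : u == v = false) //.
by apply: contraTF uv => /eqP->; rewrite e_irr.
Qed.

End Distance.


(** * The diameter bound by AM-GM *)

Theorem corollary3 (R : realType) (T : finType) (e : rel T) (n m : nat)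
    (e_sym : symmetric e) (e_irr : irreflexive e)
    (e_conn : connected_graph e) (e_planar : planar R e)
    (n_def : n = #|T|) (m_def : m = #|edges e|) (m_ge1 : (1 <= m)%N) :
  (diameter e)%:R <= 4 * n%:R ^+ 2 / (3 * m%:R) :> R.
Proof.
have T0 : (0 < #|T|)%N by case/andP: e_conn.
have [x [y diam]] : exists x y, diameter e = dist e x y.
  have [x def_x] := @bigop.eq_bigmax T (fun x => \max_y dist e x y)%N T0.
  have [y def_y] := @bigop.eq_bigmax T (dist e x) T0.
  by exists x, y; rewrite /diameter def_x def_y.
rewrite ler_pdivlMr ?mulr_gt0 ?ltr0n // -natrX -!natrM ler_nat diam.
have [->|D0] := posnP (dist e x y); first by rewrite mul0n.
have [pos [arc drawing]] := e_planar.
have free : ~ has_K5_minor [set: T] e by exact: (drawing_no_K5_minor drawing).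
have lev := dist_leveling x e_sym e_conn.
have clique1 z : is_clique e [set z] by move=> u v /set1P-> /set1P->; rewrite eqxx.
(* Both ends are singletons, [x] being level 0, hence trivially cliques. *)
have := @layer_bound T (dist e x y) [set: T] e (dist e x) [set y] e_sym e_irr free lev.
rewrite dist_level0 // !cards1 => /(_ (clique1 x) isT (subsetT _) (clique1 y) isT).
have far : forall b, b \in [set y] -> (dist e x y <= dist e x b)%N by move=> b /set1P->.
move=> /(_ far D0); rewrite cardsT -n_def; have := card_edges_le e_sym e_irr.
rewrite -m_def; move: (arc_count _ _) (dist e x y) => a D; clear.
move=> ma bound; have sum_le : (m + 3 * D <= 4 * n)%N by lia.
(* AM-GM for [m] and [3 * D]: four times their product is at most [(m + 3 * D) ^ 2], hence at most
   [(4 * n) ^ 2]. *)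
rewrite -(leq_pmul2l (isT : (0 < 4)%N)) (_ : (D * (3 * m) = m * (3 * D))%N); last by lia.
have -> : (4 * (4 * n ^ 2) = (4 * n) ^ 2)%N by rewrite expnMn; lia.
by apply: leq_trans (nat_AGM2 _ _) _; rewrite leq_sqr.
Qed.
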